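(* Consider the multinomial logistic model described in the context, with Fisher information matrix $\mathbf F$. Let $k=\#\{i:n_i>0\}$ and let $\mathbf H^*$ be the $p\times k(J-1)$ matrix obtained from $\mathbf H$ by removing all columns associated with indices $i$ such that $n_i=0$. Then $\mathbf F$ is positive definite if and only if $\mathbf H^*$ is of full row rank. Furthermore, if $n_i>0$ for all $i=1,\dots,m$, then $\mathbf F$ is positive definite if and only if $\mathbf H$ is of full row rank.
   Context: Let $d\ge 1$, $m\ge 2$, $J\ge 2$ be integers, $\mathbf x_1,\dots,\mathbf x_m\in\mathbb R^d$ distinct experimental settings, and $n_1,\dots,n_m\ge 0$ integers with $n=\sum_i n_i>0$. For each $i$ with $n_i>0$ one observes $\mathbf Y_i=(Y_{i1},\dots,Y_{iJ})^T\sim{\rm Multinomial}(n_i;\pi_{i1},\dots,\pi_{iJ})$, independently over $i$, where $\sum_j\pi_{ij}=1$. Model. Known functions $\mathbf h_j$ with values in $\mathbb R^{p_j}$ ($j=1,\dots,J-1$) and $\mathbf h_c$ with values in $\mathbb R^{p_c}$ are given; the parameter is $\boldsymbol\theta=(\boldsymbol\beta_1^T,\dots,\boldsymbol\beta_{J-1}^T,\boldsymbol\zeta^T)^T\in\mathbb R^p$ with $\boldsymbol\beta_j\in\mathbb R^{p_j}$, $\boldsymbol\zeta\in\mathbb R^{p_c}$, $p=p_1+\dots+p_{J-1}+p_c$. ($p_c=0$, i.e. no $\mathbf h_c,\boldsymbol\zeta$, is allowed.) For one fixed choice among four logit types, $\log(\nu_{ij}/\delta_{ij})=\mathbf h_j^T(\mathbf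 x_i)\boldsymbol\beta_j+\mathbf h_c^T(\mathbf x_i)\boldsymbol\zeta$ for $j=1,\dots,J-1$, where $(\nu_{ij},\delta_{ij})$ is: $(\pi_{ij},\pi_{iJ})$ (baseline-category); $(\pi_{i1}+\dots+\pi_{ij},\ \pi_{i,j+1}+\dots+\pi_{iJ})$ (cumulative); $(\pi_{ij},\pi_{i,j+1})$ (adjacent-categories); $(\pi_{ij},\ \pi_{i,j+1}+\dots+\pi_{iJ})$ (continuation-ratio). It is assumed that $\pi_{ij}>0$ for all $i,j$. The Fisher information matrix $\mathbf F$ ($p\times p$) is the covariance matrix of the score vector $\partial l/\partial\boldsymbol\theta$, where $l$ is the log-likelihood of $(\mathbf Y_i)_i$. $\mathbf H$ is the $p\times m(J-1)$ matrix $\mathbf H=\begin{pmatrix}\mathbf H_1&&\\&\ddots&\\&&\mathbf H_{J-1}\\ \mathbf H_c&\cdots&\mathbf H_c\end{pmatrix}$ with $\mathbf H_j=(\mathbf h_j(\mathbf x_1),\dots,\mathbf h_j(\mathbf x_m))$ ($p_j\times m$) and $\mathbf H_c=(\mathbf h_c(\mathbf x_1),\dots,\mathbf h_c(\mathbf x_m))$ ($p_c\times m$). In each of the $J-1$ blocks of $m$ columns, the $i$th column is the one associated with $\mathbf x_i$ (equivalently with the index $i$). *)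

(* Defs.v *)
From HB Require Import structures.
From mathcomp Require Import all_boot all_order all_algebra.
From mathcomp Require Import all_classical all_reals all_analysis.
Set Implicit Arguments.
Unset Strict Implicit.
Unset Printing Implicit Defensive.
Import Order.TTheory GRing.Theory Num.Theory.
Import numFieldNormedType.Exports.
Local Open Scope classical_set_scope.
Local Open Scope ring_scope.

Definition posdefmx (R : realType) (p : nat) (A : 'M[R]_p) : Prop :=
  A^T = A /\ forall v : 'cV[R]_p, v != 0 -> 0 < (v^T *m A *m v) 0 0.

Inductive logit_type : Type :=
  Baseline | Cumulative | Adjacent | Continuation.

(* Categories are numbered from 0: the ordinals 0, ..., J-1 stand for the
   categories 1, ..., J, and the j-th logit (j : 'I_J.-1) is the (j+1)-st of
   the usual numbering.  [logit_num] and [logit_den] say which categories l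
   contribute to the numerator nu_j and to the denominator delta_j. *)
Definition logit_num (g : logit_type) (j l : nat) : bool :=
  match g with
  | Cumulative => (l <= j)%N
  | Baseline | Adjacent | Continuation => l == j
  end.

Definition logit_den (g : logit_type) (J j l : nat) : bool :=
  match g with
  | Baseline => l == J.-1
  | Adjacent => l == j.+1
  | Cumulative | Continuation => (j < l)%N
  end.

Section DesignMatrix.
Variables (R : realType) (d m J pc : nat) (p_ : 'I_J.-1 -> nat).
Variables (h : forall j : 'I_J.-1, 'cV[R]_d -> 'cV[R]_(p_ j)).
Variables (hc : 'cV[R]_d -> 'cV[R]_pc) (x : 'I_m -> 'cV[R]_d).

Definition blockH (j : 'I_J.-1) : 'M[R]_(p_ j, m) :=
  \matrix_(s, i) h j (x i) s 0.

Definition blockHc : 'M[R]_(pc, m) := \matrix_(s, i) hc (x i) s 0.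

Definition designH :
    'M[R]_((\sum_(j < J.-1) p_ j) + pc, \sum_(j < J.-1) m) :=
  col_mx
    (\mxblock_(j < J.-1, l < J.-1) (if j == l then blockH j else 0))
    (\mxrow_(j < J.-1) blockHc).

Variable n : 'I_m -> nat.

(* A column c of [designH] sits at position [tagnat.sig2 c : 'I_m] of the
   block [tagnat.sig1 c : 'I_J.-1]. *)
Definition kept_cols : {set 'I_(\sum_(j < J.-1) m)} :=
  [set c | (0 < n (tagnat.sig2 c))%N]%SET.

Lemma card_kept_cols :
  #|kept_cols| = (#|[set i : 'I_m | (0 < n i)%N]%SET| * J.-1)%N.
Proof.
pose A := [set i : 'I_m | (0 < n i)%N]%SET.
pose f (u : 'I_m * 'I_J.-1) : 'I_(\sum_(j < J.-1) m) :=
  @tagnat.Rank _ (fun=> m) u.2 u.1.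
have fK (u : 'I_m * 'I_J.-1) : val (tagnat.sig2 (f u)) = val u.1.
  by rewrite /f tagnat.Rank2K.
have f_inj : injective f.
  move=> [i j] [i' j'] e.
  have /= e1 : val i = val i' by rewrite -(fK (i, j)) -(fK (i', j')) e.
  have /= e2 : j = j'.
    have := congr1 (@tagnat.sig1 _ (fun=> m)) e.
    by rewrite /f !tagnat.Rank1K.
  by congr (_, _) => //; apply: val_inj.
have -> : kept_cols = (f @: finset.setX A [set: 'I_J.-1])%SET.
  apply/setP => c; rewrite inE; apply/idP/imsetP => [nc|[u]].
    exists (tagnat.sig2 c : 'I_m, tagnat.sig1 c); first by rewrite !inE andbT.
    by rewrite /f /= tagnat.sig2K.
  rewrite !inE andbT => nu ->.
  suff -> : tagnat.sig2 (f u) = u.1 :> 'I_m by [].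
  exact: val_inj (fK u).
by rewrite card_imset // cardsX cardsT card_ord.
Qed.

Definition designHstar :
    'M[R]_((\sum_(j < J.-1) p_ j) + pc, #|kept_cols|) :=
  colsub (@enum_val _ (mem kept_cols)) designH.

End DesignMatrix.

Section Model.
Variables (R : realType) (g : logit_type) (d m J pc : nat).
Variable p_ : 'I_J.-1 -> nat.
Local Notation p := ((\sum_(j < J.-1) p_ j) + pc)%N.
Variables (h : forall j : 'I_J.-1, 'cV[R]_d -> 'cV[R]_(p_ j)).
Variables (hc : 'cV[R]_d -> 'cV[R]_pc) (x : 'I_m -> 'cV[R]_d).

Definition beta (theta : 'cV[R]_p) (j : 'I_J.-1) : 'cV[R]_(p_ j) :=
  submxcol (usubmx theta) j.

Definition zeta (theta : 'cV[R]_p) : 'cV[R]_pc := dsubmx theta.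

Definition logit_model (theta : 'cV[R]_p) (pi : 'M[R]_(m, J)) : Prop :=
  [/\ forall i j, 0 < pi i j,
      forall i, \sum_(j < J) pi i j = 1 &
      forall (i : 'I_m) (j : 'I_J.-1),
        ln ((\sum_(l < J | logit_num g j l) pi i l) /
            (\sum_(l < J | logit_den g J j l) pi i l)) =
        ((h j (x i))^T *m beta theta j + (hc (x i))^T *m zeta theta) 0 0].

(* For cumulative logits some theta are infeasible: the linear predictors must
   increase with j.  For the other three types every theta is feasible. *)
Definition feasible (theta : 'cV[R]_p) : Prop :=
  exists pi, logit_model theta pi.

(* The logit equations determine pi from theta, so that for a feasible theta
   [get] picks the unique solution. *)
Definition cat_prob (theta : 'cV[R]_p) : 'M[R]_(m, J) :=
  get [set pi | logit_model theta pi].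

Definition multinomial_pmf (N : nat) (q : 'I_J -> R) (y : 'I_J -> nat) : R :=
  if (\sum_(j < J) y j == N)%N then
    N`!%:R / (\prod_(j < J) (y j)`!)%:R * \prod_(j < J) q j ^+ y j
  else 0.

Variable n : 'I_m -> nat.

Definition log_likelihood (y : 'I_m -> 'I_J -> nat) (theta : 'cV[R]_p) : R :=
  ln (\prod_(i < m | (0 < n i)%N)
        multinomial_pmf (n i) (cat_prob theta i) (y i)).

Definition score (theta : 'cV[R]_p) (s : 'I_p) (y : 'I_m -> 'I_J -> nat) : R :=
  'D_(delta_mx s 0) (log_likelihood y) theta.

Section Sampling.
Variables (disp : measure_display) (T : measurableType disp).
Variables (Pr : probability T R) (Y : 'I_m -> 'I_J -> {RV Pr >-> nat}).

(* 'I_J -> nat is countable and the Y i j are measurable, so every set B of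
   count vectors defines an event and no measurability condition is needed. *)
Definition in_event (i : 'I_m) (B : set ('I_J -> nat)) : set T :=
  [set w | B (fun j => Y i j w)].

Definition multinomial_counts (theta : 'cV[R]_p) : Prop :=
  forall (i : 'I_m) (y : 'I_J -> nat), (0 < n i)%N ->
    Pr (in_event i [set y]) = (multinomial_pmf (n i) (cat_prob theta i) y)%:E.

Definition independent_counts : Prop :=
  forall (S : {set 'I_m}) (B : 'I_m -> set ('I_J -> nat)),
    (forall i, i \in S -> (0 < n i)%N) ->
    Pr (\bigcap_(i in [set` S]) in_event i (B i)) =
    (\prod_(i in S) Pr (in_event i (B i)))%E.

(* The covariance is taken under Pr, the distribution of the data at theta. *)
Definition fisher (theta : 'cV[R]_p) : 'M[R]_p :=
  \matrix_(s, t) fine (covariance Pr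
    (fun w => score theta s (fun i j => Y i j w))
    (fun w => score theta t (fun i j => Y i j w))).

End Sampling.
End Model.

(* Main.v *)
(* Near theta the category probabilities pi_i at the setting x_i solve a linear
   system: nu_ij - exp(eta_ij) delta_ij = 0 for the J-1 logits, and
   sum_j pi_ij = 1, where eta_ij is the linear predictor.  The matrix of this
   system is invertible for all four logit types, so pi_i is unique and, by
   Cramer's rule, differentiable.  The score is therefore
   sum_(i, j) Y_ij (D_s pi_ij / pi_ij), which is centered, and by independence
     v^T F v = sum_i E[(sum_j Y_ij (sum_s v_s D_s pi_ij) / pi_ij)^2].
   Evaluating at the counts n_i e_j shows that this vanishes iff
   sum_s v_s D_s pi_i = 0 whenever n_i > 0.  Differentiating the linear system,
   this means that the linear predictors of v vanish at these x_i, and they are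
   the entries of v^T H^*. *)
Require Import Defs.
From HB Require Import structures.
From mathcomp Require Import all_boot all_order all_algebra.
From mathcomp Require Import ring.
From mathcomp Require Import all_classical all_reals all_analysis.
Set Implicit Arguments.
Unset Strict Implicit.
Unset Printing Implicit Defensive.
Import Order.TTheory GRing.Theory Num.Theory.
Import numFieldNormedType.Exports.
Local Open Scope classical_set_scope.
Local Open Scope ring_scope.

(** * The linear system of the category probabilities *)

(** Outside the cumulative case each numerator is a single category and the denominator involves
    only later ones, so signs propagate downwards from the last category. The induction is on the
    distance to that category. *)
Lemma logit_system_ge0 (R : realFieldType) (g : logit_type) (J : nat)
    (r : 'I_J.-1 -> R) (u : 'I_J -> R) :
  g <> Defs.Cumulative -> (forall j, 0 < r j) ->
  (forall j : 'I_J.-1, \sum_(l < J | logit_num g j l) u l =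
     r j * \sum_(l < J | logit_den g J j l) u l) ->
  (forall l : 'I_J, l = J.-1 :> nat -> 0 <= u l) -> forall l, 0 <= u l.
Proof.
move=> gNC r_gt0 rel u_last.
suff : forall k (l : 'I_J), (J.-1 - l < k)%N -> 0 <= u l by move=> H l; exact: H.
elim=> // k IH l lk.
have [lJ|lJ] := ltnP l J.-1; last first.
  by apply: u_last; apply/eqP; rewrite eqn_leq lJ andbT -ltnS
    (leq_trans (ltn_ord l)) ?leqSpred.
have := rel (Ordinal lJ).
have -> : \sum_(l' < J | logit_num g (Ordinal lJ) l') u l' = u l.
  by case: g gNC {rel} => // _ /=; rewrite (big_pred1 l).
move=> ->; apply: mulr_ge0; first exact/ltW.
apply: sumr_ge0 => l' den; apply: IH.
have ll' : (l < l')%N.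
  case: g gNC den {rel} => // _ /=; first by move/eqP->.
  by move/eqP->.
by apply: (@leq_trans (J.-1 - l)) => //; exact: ltn_sub2l.
Qed.

(* The same linear system expresses that two probability vectors have equal
   logits and that a tangent vector is annihilated by the derivative of the
   logits: this gives both identifiability and local invertibility. *)
Lemma logit_system_inj (R : realFieldType) (g : logit_type) (J : nat)
    (r : 'I_J.-1 -> R) (u : 'I_J -> R) :
  (forall j, 0 < r j) ->
  (forall j : 'I_J.-1, \sum_(l < J | logit_num g j l) u l =
     r j * \sum_(l < J | logit_den g J j l) u l) ->
  \sum_l u l = 0 -> forall l, u l = 0.
Proof.
move=> r_gt0 rel sum0 l.
have J_gt0 : (0 < J)%N by exact: leq_ltn_trans (ltn_ord l).
have [gC|gNC] : g = Defs.Cumulative \/ g <> Defs.Cumulative.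
    by case: g {rel}; [right|left|right|right].
  rewrite gC /= {g gC} in rel.
  (* Since the total is 0, the tail beyond k is minus the partial sum, and the k-th equation says
     that 1 + r_k times the partial sum is 0. Each entry of u is then a difference of consecutive
     partial sums. *)
  have cum0 (k : nat) : \sum_(l < J | (l <= k)%N) u l = 0.
    have [kJ|kJ] := ltnP k J.-1; last first.
      rewrite -[RHS]sum0; apply: eq_bigl => l'; rewrite (leq_trans _ kJ) //.
      by rewrite -ltnS (prednK J_gt0) ltn_ord.
    move: sum0 (rel (Ordinal kJ)) => /=.
    rewrite (bigID (fun l : 'I_J => (l <= k)%N)) /=.
    under [X in _ + X]eq_bigl do rewrite -ltnNge.
    move=> /eqP; rewrite addr_eq0 => /eqP ->.
    move=> /eqP; rewrite -subr_eq0 -opprD oppr_eq0 -[X in X + _]mul1r -mulrDl.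
    rewrite mulf_eq0 gt_eqF ?addr_gt0 //= => /eqP ->.
    by rewrite oppr0.
  have := cum0 l; rewrite (bigD1 l) //=.
  case: (posnP l) => [l0|l_gt0].
    rewrite big1 ?addr0 // => i; rewrite l0 leqn0 => /andP[/eqP i0 /eqP].
    by case; apply: val_inj; rewrite /= i0 l0.
  rewrite (eq_bigl (fun i : 'I_J => (i <= l.-1)%N)) ?cum0 ?addr0 // => i.
  by rewrite -[in RHS]ltnS prednK // [in RHS]ltn_neqAle andbC.
(* In the other three cases the sign of the last entry spreads to all entries, and entries of one
   sign with sum 0 vanish. A negative last entry is handled by passing to -u. *)
have rel_sgn (v : 'I_J -> R) :
    (forall j : 'I_J.-1, \sum_(l < J | logit_num g j l) v l =
     r j * \sum_(l < J | logit_den g J j l) v l) -> \sum_l v l = 0 ->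
    (forall l : 'I_J, l = J.-1 :> nat -> 0 <= v l) -> forall l, v l = 0.
  move=> relv sumv0 v_last l'.
  have v_ge0 := @logit_system_ge0 _ g _ r v gNC r_gt0 relv v_last.
  by apply: (psumr_eq0P _ sumv0) => // ? _; exact: v_ge0.
have ltJ : (J.-1 < J)%N by rewrite ltn_predL.
have [u_ge0|u_lt0] := leP 0 (u (Ordinal ltJ)).
  apply: rel_sgn => // l' l'J; suff -> : l' = Ordinal ltJ by [].
  exact: val_inj.
apply/eqP; rewrite -oppr_eq0; apply/eqP.
apply: (rel_sgn (fun l => - u l)) => [j||l' l'J].
- by rewrite !sumrN rel mulrN.
- by rewrite sumrN sum0 oppr0.
- suff -> : l' = Ordinal ltJ by rewrite oppr_ge0 ltW.
  exact: val_inj.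
Qed.

(* The last row expresses that the probabilities add up to one. *)
Definition logit_mx {R : pzRingType} (g : logit_type) {J : nat}
    (r : 'I_J.-1 -> R) : 'M[R]_J :=
  \matrix_(k, l) if insub (k : nat) is Some j
    then (logit_num g (j : 'I_J.-1) l)%:R - r j * (logit_den g J j l)%:R else 1.

Lemma mul_logit_mx {R : pzRingType} (g : logit_type) (J : nat)
    (r : 'I_J.-1 -> R) (u : 'cV[R]_J) (k : 'I_J) :
  (logit_mx g r *m u) k 0 = if insub (k : nat) is Some j
    then \sum_(l < J | logit_num g (j : 'I_J.-1) l) u l 0 -
         r j * \sum_(l < J | logit_den g J j l) u l 0
    else \sum_l u l 0.
Proof.
rewrite mxE; case: insubP => [j _ jk|kJ].
  rewrite big_distrr /= [X in X - _]big_mkcond [X in _ - X]big_mkcond -sumrB.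
  apply: eq_bigr => l _; rewrite mxE -jk valK.
  by rewrite mulrBl -mulrA !mulr_natl mulrnAr !mulrb.
by apply: eq_bigr => l _; rewrite mxE insubN ?mul1r.
Qed.

(** A kernel vector solves the homogeneous system, hence is 0 by [logit_system_inj]. The transpose
    appears because row freeness concerns left kernels. *)
Lemma logit_mx_unit (R : realFieldType) (g : logit_type) (J : nat)
    (r : 'I_J.-1 -> R) : (forall j, 0 < r j) -> logit_mx g r \in unitmx.
Proof.
move=> r_gt0; rewrite -unitmx_tr -row_free_unit; apply: inj_row_free => v.
move=> /(congr1 trmx); rewrite trmx_mul trmxK trmx0 => /colP Mv0.
apply/rowP => l; rewrite mxE -[v]trmxK mxE.
apply: (@logit_system_inj _ g _ r (fun l => v^T l 0)) => // [j|].
  have := Mv0 (widen_ord (leq_pred J) j).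
  by rewrite mul_logit_mx /= valK mxE => /eqP; rewrite subr_eq0 => /eqP.
have J_gt0 : (0 < J)%N by exact: leq_ltn_trans (ltn_ord l).
have ltJ : (J.-1 < J)%N by rewrite ltn_predL.
by have := Mv0 (Ordinal ltJ); rewrite mul_logit_mx /= insubN ?ltnn // mxE.
Qed.

Definition logit_rhs (R : pzRingType) (J : nat) : 'cV[R]_J :=
  \col_k (k == J.-1 :> nat)%:R.

Lemma logit_mxP (R : pzRingType) (g : logit_type) (J : nat)
    (r : 'I_J.-1 -> R) (u : 'cV[R]_J) : (0 < J)%N ->
  logit_mx g r *m u = logit_rhs R J <->
  \sum_l u l 0 = 1 /\ forall j : 'I_J.-1,
    \sum_(l < J | logit_num g j l) u l 0 =
    r j * \sum_(l < J | logit_den g J j l) u l 0.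
Proof.
move=> J_gt0; have ltJ : (J.-1 < J)%N by rewrite ltn_predL.
split=> [/colP Mu|[sum1 rel]].
  split=> [|j].
    have := Mu (Ordinal ltJ).
    by rewrite mul_logit_mx /= insubN ?ltnn // mxE eqxx.
  have := Mu (widen_ord (leq_pred J) j).
  rewrite mul_logit_mx /= valK mxE /= ltn_eqF //.
  by move=> /eqP; rewrite subr_eq0 => /eqP.
apply/colP => k; rewrite mul_logit_mx mxE; case: insubP => [j jJ jk|kJ].
  by rewrite rel subrr ltn_eqF.
rewrite sum1; suff -> : k == J.-1 :> nat by [].
by rewrite -leqNgt in kJ; rewrite eqn_leq kJ andbT -ltnS prednK ?ltn_ord.
Qed.

(** * Differentiability of the category probabilities *)

(** Reduces directional derivatives to one real variable, so that feasibility is needed only on a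
    small segment of a line through theta. *)
Lemma is_derive_line (R : numFieldType) (V W : normedModType R) (f : V -> W)
    (x v : V) (df : W) :
  is_derive x v f df <-> is_derive (0 : R) 1 (fun t => f (t *: v + x)) df.
Proof.
have eqD : 'D_v f x = 'D_1 (fun t : R => f (t *: v + x)) 0.
  rewrite /derive; set g1 := fun h => h^-1 *: _; set g2 := fun h => h^-1 *: _.
  suff -> : g1 = g2 by [].
  by rewrite funeqE /g1 /g2 => h /=; rewrite addr0 scale0r add0r [_%:A]mulr1.
split=> -[der <-]; apply: DeriveDef => //; first exact/(derivable1P f x v).1.
exact/(derivable1P f x v).2.
Qed.

Lemma is_derive_bigsum (R : numFieldType) (V W : normedModType R) (I : Type)
    (s : seq I) (P : pred I) (f : I -> V -> W) (df : I -> W) (x v : V) :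
  (forall i, P i -> is_derive x v (f i) (df i)) ->
  is_derive x v (fun t => \sum_(i <- s | P i) f i t) (\sum_(i <- s | P i) df i).
Proof.
move=> fP; elim: s => [|i s IH].
  under eq_fun do rewrite big_nil; rewrite big_nil; exact: is_derive_cst.
under eq_fun do rewrite big_cons; rewrite big_cons.
by case: ifP => // Pi; apply: is_deriveD => //; exact: fP.
Qed.

Lemma derivable_bigsum (R : numFieldType) (V W : normedModType R) (I : Type)
    (s : seq I) (P : pred I) (f : I -> V -> W) (x v : V) :
  (forall i, P i -> derivable (f i) x v) ->
  derivable (fun t => \sum_(i <- s | P i) f i t) x v.
Proof.
move=> fP; apply: ex_derive; apply: is_derive_bigsum => i Pi.
exact/derivableP/fP.
Qed.

Lemma derivable_bigprod (R : numFieldType) (V : normedModType R) (I : Type)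
    (s : seq I) (P : pred I) (f : I -> V -> R) (x v : V) :
  (forall i, P i -> derivable (f i) x v) ->
  derivable (fun t => \prod_(i <- s | P i) f i t) x v.
Proof.
move=> fP; elim: s => [|i s IH].
  by under eq_fun do rewrite big_nil; exact: derivable_cst.
under eq_fun do rewrite big_cons.
by case: ifP => // Pi; apply: derivableM => //; exact: fP.
Qed.

Lemma derivable_det (R : numFieldType) (V : normedModType R) (n : nat)
    (M : V -> 'M[R]_n) (x v : V) :
  (forall i j, derivable (fun t => M t i j) x v) ->
  derivable (fun t => \det (M t)) x v.
Proof.
move=> dM; rewrite /determinant; apply: derivable_bigsum => s _.
by apply: derivableM; [exact: derivable_cst|exact: derivable_bigprod].
Qed.

Lemma derivable_invmx (R : numFieldType) (V : normedModType R) (n : nat)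
    (M : V -> 'M[R]_n) (x v : V) :
  (forall i j, derivable (fun t => M t i j) x v) ->
  (forall t, M t \in unitmx) ->
  forall i j, derivable (fun t => invmx (M t) i j) x v.
Proof.
move=> dM uM i j.
(* [invmx] is the adjugate over the determinant only on invertible matrices; invertibility at every
   t makes this an equality of functions. *)
have -> : (fun t => invmx (M t) i j) =
    (fun t => (\det (M t))^-1 * ((-1) ^+ (j + i) * \det (row' j (col' i (M t))))).
  by apply/funext => t; rewrite /invmx uM !mxE.
apply: derivableM.
  apply: derivableV; last exact: derivable_det.
  by rewrite -unitfE -unitmxE.
apply: derivableM; first exact: derivable_cst.
apply: derivable_det => k l.
by under eq_fun do rewrite !mxE; exact: dM.
Qed.

Lemma sum_row_tr (R : nmodType) (m J : nat) (A : 'M[R]_(m, J)) (i : 'I_m)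
    (P : pred 'I_J) : \sum_(l | P l) (row i A)^T l 0 = \sum_(l | P l) A i l.
Proof. by apply: eq_bigr => l _; rewrite !mxE. Qed.

(** * Uniqueness, local feasibility and derivatives of the category probabilities *)

Section Model.
Variables (R : realType) (g : logit_type) (d m J pc : nat).
Variable p_ : 'I_J.-1 -> nat.
Local Notation p := ((\sum_(j < J.-1) p_ j) + pc)%N.
Variables (h : forall j : 'I_J.-1, 'cV[R]_d -> 'cV[R]_(p_ j)).
Variables (hc : 'cV[R]_d -> 'cV[R]_pc) (x : 'I_m -> 'cV[R]_d).

Definition linpred (theta : 'cV[R]_p) (i : 'I_m) (j : 'I_J.-1) : R :=
  ((h j (x i))^T *m beta theta j + (hc (x i))^T *m zeta theta) 0 0.

Lemma linpredP (a : R) (u v : 'cV[R]_p) i j :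
  linpred (a *: u + v) i j = a * linpred u i j + linpred v i j.
Proof.
rewrite /linpred /zeta /beta !linearP /=.
have -> : submxcol (a *: usubmx u + usubmx v) j =
    a *: submxcol (usubmx u) j + submxcol (usubmx v) j.
  by apply/matrixP => k l; rewrite !mxE.
rewrite linearP /= !mxE; ring.
Qed.

Lemma linpred_sum (I : Type) (s : seq I) (c : I -> R) (u : I -> 'cV[R]_p) i j :
  linpred (\sum_(k <- s) c k *: u k) i j = \sum_(k <- s) c k * linpred (u k) i j.
Proof.
elim: s => [|k s IH]; last by rewrite !big_cons linpredP IH.
rewrite !big_nil; have := linpredP 1 0 0 i j.
rewrite scale1r addr0 mul1r => /eqP.
by rewrite -subr_eq0 opprD addNKr oppr_eq0 => /eqP.
Qed.

(** With positive probabilities every numerator and denominator is a nonempty sum of positive terms,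
    so a logit equation can be exponentiated and cleared of its denominator, which makes it linear
    in pi. *)
Lemma logit_modelP (theta : 'cV[R]_p) (pi : 'M[R]_(m, J)) : (0 < J)%N ->
  logit_model g h hc x theta pi <->
  (forall i j, 0 < pi i j) /\
  forall i, logit_mx g (fun j => expR (linpred theta i j)) *m (row i pi)^T =
            logit_rhs R J.
Proof.
move=> J_gt0.
have [pi_gt0|npi] := pselect (forall i j, 0 < pi i j); last first.
  by split=> [[]|[]].
have sum_gt0 i (P : pred 'I_J) l : P l -> 0 < \sum_(l < J | P l) pi i l.
  move=> Pl; rewrite (bigD1 l) //= ltr_pwDl // sumr_ge0 // => l' _.
  exact/ltW.
have num_gt0 i (j : 'I_J.-1) : 0 < \sum_(l < J | logit_num g j l) pi i l.
  by apply: (sum_gt0 _ _ (widen_ord (leq_pred J) j)); case: (g) => /=.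
have den_gt0 i (j : 'I_J.-1) : 0 < \sum_(l < J | logit_den g J j l) pi i l.
  have jJ : (j.+1 < J)%N by rewrite -ltn_predRL.
  have ltJ : (J.-1 < J)%N by rewrite ltn_predL.
  have [->|gNB] : g = Baseline \/ g <> Baseline.
    by case: (g); [left|right|right|right].
    by apply: (sum_gt0 _ _ (Ordinal ltJ)) => /=.
  by apply: (sum_gt0 _ _ (Ordinal jJ)); case: (g) gNB => //=.
split=> [[_ sum1 eqs]|[_ eqs]].
  split=> // i; apply/logit_mxP => //; split=> [|j]; rewrite !sum_row_tr //.
  rewrite /linpred -eqs lnK ?posrE ?divr_gt0 // divfK //.
  by rewrite gt_eqF.
split=> // [i|i j]; have [sum1 rel] := (logit_mxP _ _ _ J_gt0).1 (eqs i).
  by rewrite sum_row_tr in sum1.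
by have := rel j; rewrite !sum_row_tr => ->; rewrite mulfK ?gt_eqF // expRK.
Qed.

(** Unlike [cat_prob], which is chosen by [get], this closed form solves the linear system at every
    theta, feasible or not, and can be differentiated; its entries need not be positive. *)
Definition cat_prob_row (theta : 'cV[R]_p) (i : 'I_m) : 'cV[R]_J :=
  invmx (logit_mx g (fun j => expR (linpred theta i j))) *m logit_rhs R J.

Lemma logit_model_unique (theta : 'cV[R]_p) (pi : 'M[R]_(m, J)) :
  (0 < J)%N -> logit_model g h hc x theta pi ->
  pi = \matrix_(i, l) cat_prob_row theta i l 0.
Proof.
move=> J_gt0 /(logit_modelP _ _ J_gt0)[_ eqs].
apply/matrixP => i l; rewrite mxE /cat_prob_row -(eqs i) mulKmx ?mxE //.
by apply: logit_mx_unit => j; exact: expR_gt0.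
Qed.

Lemma cat_probE (theta : 'cV[R]_p) (pi : 'M[R]_(m, J)) :
  (0 < J)%N -> logit_model g h hc x theta pi ->
  cat_prob g h hc x theta = pi.
Proof.
move=> J_gt0 Mpi; apply: get_unique => // pi' Mpi'.
by rewrite (logit_model_unique J_gt0 Mpi) (logit_model_unique J_gt0 Mpi').
Qed.

Lemma cat_probP (theta : 'cV[R]_p) : (0 < J)%N ->
  feasible g h hc x theta ->
  logit_model g h hc x theta (cat_prob g h hc x theta).
Proof. by move=> J_gt0 [pi Mpi]; rewrite (cat_probE J_gt0 Mpi). Qed.

Lemma derivable_cat_prob_row (theta v : 'cV[R]_p) i l :
  derivable (fun t : R => cat_prob_row (t *: v + theta) i l 0) 0 1.
Proof.
rewrite /cat_prob_row; under eq_fun do rewrite mxE.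
apply: derivable_bigsum => k _; apply: derivableM; last exact: derivable_cst.
apply: derivable_invmx => [k1 k2|t]; last first.
  by apply: logit_mx_unit => j; exact: expR_gt0.
under eq_fun do rewrite mxE.
case: insubP => [j _ _|_]; last exact: derivable_cst.
apply: derivableB; first exact: derivable_cst.
apply: derivableM; last exact: derivable_cst.
under eq_fun do rewrite linpredP.
by apply: ex_derive.
Qed.

Section Line.
Variables (theta v : 'cV[R]_p) (J_gt0 : (0 < J)%N).
Hypothesis feas : feasible g h hc x theta.

(* Solving the linear system gives probabilities that are continuous in the
   parameter, so that positivity, hence feasibility, persists near theta even
   for cumulative logits. *)
Lemma near_logit_model :
  \forall t \near (0 : R), logit_model g h hc x (t *: v + theta)
    (\matrix_(i, l) cat_prob_row (t *: v + theta) i l 0).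
Proof.
have pi_gt0 i l : 0 < cat_prob_row theta i l 0.
  have [+ _ _] := cat_probP J_gt0 feas.
  by rewrite (logit_model_unique J_gt0 (cat_probP J_gt0 feas)) => /(_ i l); rewrite mxE.
(* Positivity at t = 0 persists by continuity; there are finitely many pairs (i, l), so the
   neighbourhoods intersect in a neighbourhood. *)
have near_gt0 : \forall t \near (0 : R),
    forall i l, 0 < cat_prob_row (t *: v + theta) i l 0.
  have near_il i l :
      \forall t \near (0 : R), 0 < cat_prob_row (t *: v + theta) i l 0.
    have /derivable1_diffP/differentiable_continuous cont :=
      @derivable_cat_prob_row theta v i l.
    by apply: (cvgr_gt _ cont); rewrite scale0r add0r.
  have near_i i :
      \forall t \near (0 : R), forall l, 0 < cat_prob_row (t *: v + theta) i l 0.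
    exact: (@filter_forall _ _ (fun l t => _) _ _ (near_il i)).
  exact: (@filter_forall _ _ (fun i t => _) _ _ near_i).
near=> t; apply/logit_modelP => //; split=> [i l|i].
  by rewrite mxE; move: i l; near: t.
rewrite [X in _ *m X](_ : _ = cat_prob_row (t *: v + theta) i).
  rewrite mulKVmx //.
  by apply: logit_mx_unit => j; exact: expR_gt0.
by apply/colP => l; rewrite !mxE.
Unshelve. all: by end_near. Qed.

Lemma near_cat_prob : \forall t \near (0 : R),
  cat_prob g h hc x (t *: v + theta) =
  \matrix_(i, l) cat_prob_row (t *: v + theta) i l 0.
Proof.
have := near_logit_model; apply: filterS => t; exact: cat_probE.
Qed.

Lemma near_cat_prob_model : \forall t \near (0 : R),
  logit_model g h hc x (t *: v + theta) (cat_prob g h hc x (t *: v + theta)).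
Proof.
have := near_logit_model; apply: filterS => t Mt.
by rewrite (cat_probE J_gt0 Mt).
Qed.

Definition dcat_prob i l : R := 'D_v (fun th => cat_prob g h hc x th i l) theta.

Lemma is_derive_cat_prob i l :
  is_derive (0 : R) 1 (fun t => cat_prob g h hc x (t *: v + theta) i l)
    (dcat_prob i l).
Proof.
apply/(is_derive_line (fun th => cat_prob g h hc x th i l) theta v _).1.
apply: derivableP; apply/derivable1P.
apply: near_eq_derivable (@derivable_cat_prob_row theta v i l).
have := near_cat_prob; apply: filterS => t ->.
by rewrite mxE.
Qed.

Lemma dcat_prob_sum i : \sum_l dcat_prob i l = 0.
Proof.
have dsum : is_derive (0 : R) 1
    (fun t => \sum_l cat_prob g h hc x (t *: v + theta) i l)
    (\sum_l dcat_prob i l).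
  by apply: is_derive_bigsum => l _; exact: is_derive_cat_prob.
have dcst : is_derive (0 : R) 1
    (fun t => \sum_l cat_prob g h hc x (t *: v + theta) i l) 0.
  (* At infeasible parameters [cat_prob] is a default matrix, so the sum is known to be 1 only near
     t = 0. *)
  apply: (@near_eq_is_derive R R R (cst (1 : R))).
  by have := near_cat_prob_model; apply: filterS => t [_ ->].
by rewrite -(@derive_val _ _ _ _ _ _ _ dsum) (@derive_val _ _ _ _ _ _ _ dcst).
Qed.

(** Product rule for nu = exp(eta) delta, an identity valid near theta along the direction v. *)
Lemma dcat_prob_rel i (j : 'I_J.-1) :
  \sum_(l < J | logit_num g j l) dcat_prob i l =
  expR (linpred theta i j) *
    (linpred v i j * \sum_(l < J | logit_den g J j l) cat_prob g h hc x theta i l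
     + \sum_(l < J | logit_den g J j l) dcat_prob i l).
Proof.
have dnum : is_derive (0 : R) 1
    (fun t => \sum_(l < J | logit_num g j l) cat_prob g h hc x (t *: v + theta) i l)
    (\sum_(l < J | logit_num g j l) dcat_prob i l).
  by apply: is_derive_bigsum => l _; exact: is_derive_cat_prob.
have dden : is_derive (0 : R) 1
    (fun t => \sum_(l < J | logit_den g J j l) cat_prob g h hc x (t *: v + theta) i l)
    (\sum_(l < J | logit_den g J j l) dcat_prob i l).
  by apply: is_derive_bigsum => l _; exact: is_derive_cat_prob.
have dexp : is_derive (0 : R) 1 (fun t => expR (linpred (t *: v + theta) i j))
    (expR (linpred theta i j) * linpred v i j).
  apply: (@is_derive1_comp _ expR).
    by rewrite scale0r add0r; exact: is_derive_expR.
  under eq_fun do rewrite linpredP.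
  by apply: is_derive_eq; rewrite ?scaler0 ?add0r ?addr0; apply: mulr1.
have := is_deriveM dexp dden.
move=> /(@near_eq_is_derive R R R _ (fun t : R => \sum_(l < J | logit_num g j l)
   cat_prob g h hc x (t *: v + theta) i l)) H.
rewrite -(@derive_val _ _ _ _ _ _ _ dnum).
rewrite (@derive_val _ _ _ _ _ _ _ (H _)).
  rewrite scale0r add0r /GRing.scale /=; ring.
have := near_cat_prob_model; apply: filterS => t /(logit_modelP _ _ J_gt0)[_ /(_ i)].
move=> /(logit_mxP _ _ _ J_gt0)[_ /(_ j)] e; apply/esym.
by rewrite !sum_row_tr in e.
Qed.

End Line.

(** The combination U of partial derivatives has sum 0 and satisfies the differentiated logit
    equations. If U = 0, these leave the predictor of v times a positive denominator equal to 0; if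
    the predictors vanish, U solves the homogeneous system. Working with partial derivatives matches
    the quadratic form and avoids proving that the derivative is linear in its direction. *)
Lemma dcat_prob_comb_eq0 (theta v : 'cV[R]_p) i : (0 < J)%N ->
  feasible g h hc x theta ->
  (forall l, \sum_s v s 0 * dcat_prob theta (delta_mx s 0) i l = 0) <->
  (forall j, linpred v i j = 0).
Proof.
move=> J_gt0 feas.
set U := fun l => \sum_s v s 0 * dcat_prob theta (delta_mx s 0) i l.
have vE : v = \sum_s v s 0 *: delta_mx s 0.
  rewrite [LHS]matrix_sum_delta; apply: eq_bigr => s _.
  by rewrite big_ord1.
have sumU (P : pred 'I_J) : \sum_(l | P l) U l =
    \sum_s v s 0 * \sum_(l | P l) dcat_prob theta (delta_mx s 0) i l.
  by rewrite exchange_big; apply: eq_bigr => s _; rewrite big_distrr.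
have sumU0 : \sum_l U l = 0.
  by rewrite sumU big1 // => s _; rewrite dcat_prob_sum ?mulr0.
have [pi_gt0 _ _] := cat_probP J_gt0 feas.
pose D j := \sum_(l < J | logit_den g J j l) cat_prob g h hc x theta i l.
have rel (j : 'I_J.-1) : \sum_(l < J | logit_num g j l) U l =
    expR (linpred theta i j) *
    (linpred v i j * D j + \sum_(l < J | logit_den g J j l) U l).
  rewrite !sumU {2}vE linpred_sum big_distrl /= -big_split /= big_distrr /=.
  by apply: eq_bigr => s _; rewrite (dcat_prob_rel _ J_gt0 feas) -/(D _); ring.
split=> [U0 j|v0 l].
  have := rel j; rewrite [X in X = _]big1; last by move=> l _; exact: U0.
  rewrite [X in _ + X]big1 ?addr0; last by move=> l _; exact: U0.
  move=> /esym/eqP.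
  rewrite mulf_eq0 gt_eqF ?expR_gt0 //= mulf_eq0 => /orP[/eqP //|].
  rewrite /D; have jJ : (j.+1 < J)%N by rewrite -ltn_predRL.
  have ltJ : (J.-1 < J)%N by rewrite ltn_predL.
  suff [l denl] : exists l : 'I_J, logit_den g J j l.
    rewrite gt_eqF // (bigD1 l) //= ltr_pwDl // sumr_ge0 // => l' _.
    exact/ltW.
  by case: (g); [exists (Ordinal ltJ)|exists (Ordinal jJ)..] => /=.
apply: (@logit_system_inj _ g _ (fun j => expR (linpred theta i j)) U _ _ sumU0).
  by move=> j; exact: expR_gt0.
by move=> j; rewrite rel v0 mul0r add0r.
Qed.

End Model.

(** * The score *)

Lemma ln_bigprod (R : realType) (I : Type) (s : seq I) (P : pred I) (f : I -> R) :
  (forall i, P i -> 0 < f i) ->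
  ln (\prod_(i <- s | P i) f i) = \sum_(i <- s | P i) ln (f i).
Proof.
move=> f_gt0; elim: s => [|i s IH]; first by rewrite !big_nil ln1.
rewrite !big_cons; case: ifP => // Pi.
rewrite lnM ?IH // posrE; first exact: f_gt0.
exact: prodr_gt0.
Qed.

Section Score.
Variables (R : realType) (g : logit_type) (d m J pc : nat).
Variable p_ : 'I_J.-1 -> nat.
Local Notation p := ((\sum_(j < J.-1) p_ j) + pc)%N.
Variables (h : forall j : 'I_J.-1, 'cV[R]_d -> 'cV[R]_(p_ j)).
Variables (hc : 'cV[R]_d -> 'cV[R]_pc) (x : 'I_m -> 'cV[R]_d).
Variables (n : 'I_m -> nat) (theta : 'cV[R]_p) (J_gt0 : (0 < J)%N).
Hypothesis feas : feasible g h hc x theta.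

Let pi := cat_prob g h hc x theta.
Let dpi s := dcat_prob g h hc x theta (delta_mx s 0).

(* A count vector with a wrong total has likelihood 0, and ln 0 = 0. *)
Lemma score_eq0 s (y : 'I_m -> 'I_J -> nat) (i : 'I_m) :
  (0 < n i)%N -> (\sum_j y i j)%N != n i -> score g h hc x n theta s y = 0.
Proof.
move=> ni yi; rewrite /score.
have -> : log_likelihood g h hc x n y = cst 0.
  apply/funext => th; rewrite /log_likelihood (bigD1 i) //=.
  by rewrite /multinomial_pmf (negbTE yi) mul0r ln0.
exact: derive_cst.
Qed.

(** Near theta all probabilities are positive, so the logarithm splits the likelihood into
    multinomial coefficients, constant in theta, and a sum of counts times ln pi. *)
Lemma scoreE s (y : 'I_m -> 'I_J -> nat) :
  (forall i, (0 < n i)%N -> (\sum_j y i j)%N = n i) ->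
  score g h hc x n theta s y =
  \sum_(i < m | (0 < n i)%N) \sum_j (y i j)%:R * (dpi s i j / pi i j).
Proof.
move=> yn; rewrite /score.
have [pi_gt0 _ _] := cat_probP J_gt0 feas.
set v := delta_mx s 0.
pose C i : R := (n i)`!%:R / (\prod_(j < J) (y i j)`!)%:R.
have C_gt0 i : 0 < C i.
  rewrite divr_gt0 // ltr0n ?fact_gt0 //.
  by apply: prodn_gt0 => j; exact: fact_gt0.
suff /(is_derive_line (log_likelihood g h hc x n y) theta v _).2 D :
    is_derive (0 : R) 1 (fun t => log_likelihood g h hc x n y (t *: v + theta))
      (\sum_(i < m | (0 < n i)%N) \sum_j (y i j)%:R * (dpi s i j / pi i j)).
  by rewrite (@derive_val _ _ _ _ _ _ _ D).
have D : is_derive (0 : R) 1 (fun t => \sum_(i < m | (0 < n i)%N)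
      (ln (C i) + \sum_j (y i j)%:R * ln (cat_prob g h hc x (t *: v + theta) i j)))
      (\sum_(i < m | (0 < n i)%N) \sum_j (y i j)%:R * (dpi s i j / pi i j)).
  apply: is_derive_bigsum => i ni.
  apply: (is_derive_eq (f' := 0 + \sum_j (y i j)%:R * (dpi s i j / pi i j)));
    last exact: add0r.
  apply: (@is_deriveD R R R (cst (ln (C i))) (fun t : R =>
    \sum_j (y i j)%:R * ln (cat_prob g h hc x (t *: v + theta) i j)) _ _ (0 : R)).
  apply: is_derive_bigsum => j _.
  apply: (is_deriveZ (f := fun t : R => ln (cat_prob g h hc x (t *: v + theta) i j))).
  rewrite mulrC.
  apply: (@is_derive1_comp _ (@ln R)).
    by rewrite scale0r add0r; apply: is_derive1_ln; exact: pi_gt0.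
  exact: is_derive_cat_prob.
apply: (@near_eq_is_derive R R R) D.
have := near_cat_prob_model v J_gt0 feas; apply: filterS => t [q_gt0 _ _].
rewrite /log_likelihood ln_bigprod => [|i ni].
  apply: eq_bigr => i ni.
  rewrite /multinomial_pmf yn // eqxx -/(C i) [RHS]lnM ?posrE ?C_gt0 //; last first.
    by apply: prodr_gt0 => j _; rewrite exprn_gt0.
  congr (_ + _); rewrite ln_bigprod => [|j _]; last by rewrite exprn_gt0.
  by apply: eq_bigr => j _; rewrite lnXn // mulr_natl.
rewrite /multinomial_pmf yn // eqxx -/(C i); apply: mulr_gt0 => //.
by apply: prodr_gt0 => j _; rewrite exprn_gt0.
Qed.

End Score.

(** * Mean of the multinomial distribution *)

Section Multinomial.
Variables (R : realType) (J K : nat) (q : 'I_J -> R).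

(** Bounding counts by K makes the index set of the sums finite. The two shifts are mutually inverse
    between vectors with [y j] < K and vectors with [y j] > 0; when [y j] = K, [inord] falls back to
    0. *)
Let shift_up (j : 'I_J) (y : {ffun 'I_J -> 'I_K.+1}) : {ffun 'I_J -> 'I_K.+1} :=
  [ffun k => if k == j then inord (y j).+1 else y k].
Let shift_dn (j : 'I_J) (y : {ffun 'I_J -> 'I_K.+1}) : {ffun 'I_J -> 'I_K.+1} :=
  [ffun k => if k == j then inord (y j).-1 else y k].

Lemma multinomial_pmf_gt_bound N (y : {ffun 'I_J -> 'I_K.+1}) (j : 'I_J) :
  (N < y j)%N -> multinomial_pmf N q (fun k => y k) = 0.
Proof.
move=> Ny; rewrite /multinomial_pmf ifN //; apply/negP => /eqP sumy.
by move: Ny; rewrite -sumy (bigD1 j) //= ltnNge leq_addr.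
Qed.

(** The factor [y j] + 1 cancels against its factorial, and one factor N + 1 and one factor q_j
    split off. *)
Lemma multinomial_pmf_shift N (y : {ffun 'I_J -> 'I_K.+1}) (j : 'I_J) :
  (y j < K)%N ->
  (shift_up j y j)%:R * multinomial_pmf N.+1 q (fun k => shift_up j y k) =
  N.+1%:R * q j * multinomial_pmf N q (fun k => y k).
Proof.
move=> yK.
have upj : shift_up j y j = (y j).+1 :> nat by rewrite ffunE eqxx inordK.
have upk k : k != j -> shift_up j y k = y k :> nat.
  by move=> /negbTE kj; rewrite ffunE kj.
have sumS : (\sum_k shift_up j y k = (\sum_k y k).+1)%N.
  rewrite (bigD1 j) //= [in RHS](bigD1 j) //= upj addSn.
  by congr (_ + _).+1; apply: eq_bigr => k /upk.
have prod_fact : (\prod_k (shift_up j y k)`! = (y j).+1 * \prod_k (y k)`!)%N.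
  rewrite (bigD1 j) //= [in RHS](bigD1 j) //= upj factS -mulnA.
  by congr (_ * (_ * _))%N; apply: eq_bigr => k /upk ->.
have prod_exp : \prod_k q k ^+ shift_up j y k = q j * \prod_k q k ^+ y k.
  rewrite (bigD1 j) //= [in RHS](bigD1 j) //= upj exprS -mulrA.
  by congr (_ * (_ * _)); apply: eq_bigr => k /upk ->.
rewrite /multinomial_pmf sumS eqSS prod_fact prod_exp upj factS !natrM.
case: ifP => _; last by rewrite !mulr0.
have pnz : (\prod_k (y k)`!)%:R != 0 :> R.
  by rewrite pnatr_eq0 -lt0n prodn_gt0 // => k; exact: fact_gt0.
have y1 : (y j).+1%:R != 0 :> R by rewrite pnatr_eq0.
by field; rewrite pnz nat1r y1.
Qed.

(** Reindexing by the shift. Vectors outside its range have [y j] = 0 and weight 0; vectors outside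
    its domain have [y j] = K > N and probability 0. *)
Lemma sum_multinomial_pmf_shift N (j : 'I_J) : (N < K)%N ->
  \sum_(y : {ffun 'I_J -> 'I_K.+1})
     (y j)%:R * multinomial_pmf N.+1 q (fun k => y k) =
  N.+1%:R * q j *
  \sum_(y : {ffun 'I_J -> 'I_K.+1}) multinomial_pmf N q (fun k => y k).
Proof.
move=> NK.
rewrite (bigID (fun y : {ffun 'I_J -> 'I_K.+1} => (0 < y j)%N)) /=.
rewrite [X in _ + X]big1 ?addr0; last first.
  by move=> y; rewrite -eqn0Ngt => /eqP ->; rewrite mul0r.
rewrite (reindex_onto (shift_up j) (shift_dn j)); last first.
  move=> y y_gt0; apply/ffunP => k; rewrite !ffunE eqxx.
  case: eqP => [->|//]; rewrite inordK; first by rewrite prednK ?inord_val.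
  exact: leq_ltn_trans (leq_pred _) (ltn_ord _).
rewrite big_distrr /= [RHS](bigID (fun y : {ffun 'I_J -> 'I_K.+1} => (y j < K)%N)) /=.
rewrite [X in _ = _ + X]big1 ?addr0; last first.
  move=> y; rewrite -leqNgt => Ky; rewrite (@multinomial_pmf_gt_bound _ _ j) ?mulr0 //.
  exact: leq_trans Ky.
apply: eq_big => [y|y /andP[up_gt0 /eqP updn]].
  rewrite !ffunE eqxx; have [yK|Ky] := ltnP (y j) K.
    rewrite inordK //=; apply/eqP/ffunP => k; rewrite !ffunE eqxx.
    by case: eqP => [->|//]; rewrite inordK //= inord_val.
  by rewrite /inord /insubd insubN //= ltnS -ltnNge ltnS.
apply: multinomial_pmf_shift; move: up_gt0; rewrite ffunE eqxx.
have [//|Ky] := ltnP (y j) K.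
by rewrite /inord /insubd insubN //= ltnS -ltnNge ltnS.
Qed.

(** The multinomial theorem, by induction on N: weighting by the total N + 1 = sum_j y_j reduces N +
    1 trials to N trials through the shift. *)
Lemma sum_multinomial_pmf N : (N <= K)%N ->
  \sum_(y : {ffun 'I_J -> 'I_K.+1}) multinomial_pmf N q (fun k => y k) =
  (\sum_j q j) ^+ N.
Proof.
elim: N => [_|N IH NK].
  rewrite (bigD1 [ffun=> ord0]) //= big1 ?addr0 => [|y yn0].
    rewrite /multinomial_pmf big1 ?eqxx => [|k _]; last by rewrite ffunE.
    rewrite expr0 !big1 ?mulr1 ?divr1 // => k _; by rewrite ffunE ?expr0.
  rewrite /multinomial_pmf ifN // sum_nat_eq0; apply: contra yn0.
  move=> /forallP y0; apply/eqP/ffunP => k; rewrite ffunE; apply: val_inj.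
  exact/eqP/y0.
have : \sum_(y : {ffun 'I_J -> 'I_K.+1})
    N.+1%:R * multinomial_pmf N.+1 q (fun k => y k) =
    \sum_j \sum_(y : {ffun 'I_J -> 'I_K.+1})
     (y j)%:R * multinomial_pmf N.+1 q (fun k => y k).
  rewrite exchange_big; apply: eq_bigr => y _; rewrite -big_distrl /= -natr_sum.
  rewrite /multinomial_pmf; case: ifP => [/eqP ->//|_]; by rewrite !mulr0.
rewrite -big_distrr /=; under [RHS]eq_bigr do rewrite sum_multinomial_pmf_shift //.
rewrite -big_distrl -big_distrr /= IH 1?ltnW // -mulrA -exprS.
by apply: mulfI; rewrite pnatr_eq0.
Qed.

Lemma multinomial_mean N j : (0 < N <= K)%N -> \sum_j q j = 1 ->
  \sum_(y : {ffun 'I_J -> 'I_K.+1}) (y j)%:R * multinomial_pmf N q (fun k => y k) =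
  N%:R * q j.
Proof.
case: N => // N /= NK sumq.
by rewrite sum_multinomial_pmf_shift // sum_multinomial_pmf 1?ltnW // sumq expr1n mulr1.
Qed.

End Multinomial.

(** * The quadratic form of the Fisher information *)

(** The score will be a finite combination of indicators, so all the integrals needed become finite
    sums. *)
Lemma expectation_sum_indic (R : realType) (disp : measure_display)
    (T : measurableType disp) (P : probability T R) (I : finType)
    (A : I -> set T) (a : I -> R) :
  (forall k, measurable (A k)) ->
  expectation P (fun w => \sum_k a k * \1_(A k) w) = (\sum_k (a k)%:E * P (A k))%E.
Proof.
move=> mA; rewrite unlock.
under eq_integral do rewrite -sumEFin.
rewrite integral_sum //; last first.
  move=> k; under eq_fun do rewrite EFinM.
  by apply: integrableZl => //; exact: integrable_indic.
apply: eq_bigr => k _; under eq_integral do rewrite EFinM.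
by rewrite integralZl ?integral_indic ?setIT //; exact: integrable_indic.
Qed.

Lemma expectation_mul_sum_indic (R : realType) (disp : measure_display)
    (T : measurableType disp) (P : probability T R) (I : finType)
    (A : I -> set T) (a b : I -> R) (X Z : T -> R) :
  (forall k, measurable (A k)) ->
  X = (fun w => \sum_k a k * \1_(A k) w) ->
  Z = (fun w => \sum_k b k * \1_(A k) w) ->
  expectation P (X * Z) =
  (\sum_k \sum_l (a k * b l)%:E * P (A k `&` A l))%E.
Proof.
move=> mA -> ->.
have -> : (fun w => \sum_k a k * \1_(A k) w) * (fun w => \sum_k b k * \1_(A k) w) =
    (fun w => \sum_kl (a kl.1 * b kl.2) * \1_(A kl.1 `&` A kl.2) w) :> (T -> R).
  apply/funext => w; rewrite fctE.
  rewrite -(pair_bigA _ (fun k l => (a k * b l) * \1_(A k `&` A l) w)) /=.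
  rewrite big_distrl; apply: eq_bigr => k _; rewrite big_distrr.
  by apply: eq_bigr => l _; rewrite indicI /= mulrACA.
rewrite expectation_sum_indic; last by move=> kl; exact: measurableI.
by rewrite -(pair_bigA _ (fun k l => ((a k * b l)%:E * P (A k `&` A l))%E)).
Qed.

Lemma covariance_centered (R : realType) (disp : measure_display)
    (T : measurableType disp) (P : probability T R) (X Z : T -> R) :
  expectation P X = 0%:E -> expectation P Z = 0%:E ->
  covariance P X Z = expectation P (X * Z).
Proof.
move=> X0 Z0; rewrite covariance.unlock X0 Z0; congr expectation.
by apply/funext => w; rewrite !fctE /= !subr0.
Qed.

(** * The score as a simple function, its covariance, and the kernel of the information matrix *)

Section Sampling.
Variables (R : realType) (g : logit_type) (d m J pc : nat).
Variable p_ : 'I_J.-1 -> nat.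
Local Notation p := ((\sum_(j < J.-1) p_ j) + pc)%N.
Variables (h : forall j : 'I_J.-1, 'cV[R]_d -> 'cV[R]_(p_ j)).
Variables (hc : 'cV[R]_d -> 'cV[R]_pc) (x : 'I_m -> 'cV[R]_d).
Variables (n : 'I_m -> nat) (theta : 'cV[R]_p) (J_gt0 : (0 < J)%N).
Hypothesis feas : feasible g h hc x theta.
Variables (disp : measure_display) (T : measurableType disp).
Variables (Pr : probability T R) (Y : 'I_m -> 'I_J -> {RV Pr >-> nat}).
Hypothesis hmult : multinomial_counts g h hc x n Y theta.
Hypothesis hindep : independent_counts n Y.

Let pi := cat_prob g h hc x theta.
(** A common bound, so that one finite type of count vectors serves all settings. *)
Let K := (\max_i n i)%N.
Local Notation counts := {ffun 'I_J -> 'I_K.+1}.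
Let S := [set i : 'I_m | (0 < n i)%N]%SET.

Let pt (y : counts) : 'I_J -> nat := fun j => y j.
Let total (i : 'I_m) : set ('I_J -> nat) := [set y | (\sum_j y j)%N = n i].
Let pm (k : 'I_m * counts) : R := multinomial_pmf (n k.1) (pi k.1) (pt k.2).

Let n_le i : (n i <= K)%N. Proof. exact: leq_bigmax. Qed.

Let measurable_pt i (y : counts) : measurable (in_event Y i [set pt y]).
Proof.
have -> : in_event Y i [set pt y] =
    \bigcap_(j in [set: 'I_J]) (Y i j @^-1` [set pt y j]).
  apply/seteqP; split=> w /=; first by move=> <-.
  by move=> yw; apply/funext => j; exact: yw.
by apply: fin_bigcap_measurable => // j _; exact: measurable_funPTI.
Qed.

(** Faithful where the total is right: each count is then at most [n i], hence at most K, and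
    [inord] does not alter it. *)
Let obs (w : T) (i : 'I_m) : counts := [ffun j => inord (Y i j w)].

Let pt_obs w i : in_event Y i (total i) w -> pt (obs w i) = fun j => Y i j w.
Proof.
rewrite /in_event /total /= => sumY; apply/funext => j.
rewrite /pt ffunE inordK // ltnS (leq_trans _ (n_le i)) // -sumY (bigD1 j) //=.
exact: leq_addr.
Qed.

Let indic_pt w i y : in_event Y i (total i) w ->
  \1_(in_event Y i [set pt y]) w = (y == obs w i)%:R :> R.
Proof.
move=> tw; rewrite indicE; congr (_%:R); congr nat_of_bool.
apply/idP/eqP => [|->].
  rewrite inE /in_event /= -(pt_obs tw) => eqy; apply/ffunP => j; apply: val_inj.
  by have := congr1 (fun f => f j) eqy.
by rewrite inE /in_event /= -(pt_obs tw).
Qed.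

Let total_bigcup i : in_event Y i (total i) =
  \bigcup_(y in [set y : counts | total i (pt y)]) in_event Y i [set pt y].
Proof.
apply/seteqP; split=> w.
  move=> tw; exists (obs w i); first by rewrite /= (pt_obs tw).
  by rewrite /in_event /= (pt_obs tw).
by case=> y ty; rewrite /in_event /= => ->.
Qed.

Let measurable_total i : measurable (in_event Y i (total i)).
Proof.
by rewrite total_bigcup; apply: fin_bigcup_measurable.
Qed.

Let pi_sum i : \sum_j pi i j = 1.
Proof. by have [_ + _] := cat_probP J_gt0 feas; exact. Qed.

Let pm_eq0 (k : 'I_m * counts) : ~ total k.1 (pt k.2) -> pm k = 0.
Proof.
by move=> tk; rewrite /pm /multinomial_pmf ifN //; apply/negP => /eqP.
Qed.

(** The sampling hypothesis gives only the probabilities of single count vectors; those with the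
    right total add up to 1 by the multinomial theorem. *)
Let prob_total i : (0 < n i)%N -> Pr (in_event Y i (total i)) = 1%:E.
Proof.
move=> ni.
have -> : Pr (in_event Y i (total i)) =
    expectation Pr (fun w => \sum_(y : counts)
      (\sum_j pt y j == n i)%N%:R * \1_(in_event Y i [set pt y]) w).
  rewrite -(expectation_indic Pr (measurable_total i)); congr expectation.
  apply/funext => w; rewrite indicE.
  case: (pselect (in_event Y i (total i) w)) => [tw|ntw].
    under eq_bigr do rewrite indic_pt //.
    rewrite (bigD1 (obs w i)) //= [X in _ + X]big1 ?addr0 => [|y /negbTE ->]; last first.
      by rewrite mulr0.
    by rewrite eqxx mulr1 mem_set // (pt_obs tw) tw eqxx.
  rewrite memNset // big1 // => y _; rewrite indicE.
  case: eqP => [sy|]; last by rewrite mul0r.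
  rewrite memNset ?mulr0 // => Yw; apply: ntw; move: Yw.
  by rewrite /in_event /= => ->.
rewrite expectation_sum_indic; last by move=> y; exact: measurable_pt.
under eq_bigr do rewrite hmult // -EFinM.
rewrite sumEFin; congr EFin.
transitivity (\sum_(y : counts) pm (i, y)).
  apply: eq_bigr => y _; rewrite /pm /multinomial_pmf /=.
  by case: ifP; rewrite ?mul1r ?mulr0.
by rewrite /pm /pt /= sum_multinomial_pmf // pi_sum expr1n.
Qed.

Let W : set T := \bigcap_(i in [set` S]) in_event Y i (total i).

Let measurable_W : measurable W.
Proof. by apply: fin_bigcap_measurable. Qed.

(* Intersecting with W makes the score vanish exactly, not only almost surely,
   outside the union of these events. *)
Let Ev (k : 'I_m * counts) : set T := in_event Y k.1 [set pt k.2] `&` W.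

Let measurable_Ev k : measurable (Ev k).
Proof. exact: measurableI. Qed.

(** W is itself an intersection of one event per observed setting, so it can be absorbed factor by
    factor before independence is used; the factors other than i and j have probability 1. *)
Let prob_cap (B : 'I_m -> set ('I_J -> nat)) (i j : 'I_m) : i \in S -> j \in S ->
  i != j ->
  Pr (in_event Y i (B i) `&` in_event Y j (B j) `&` W) =
  (Pr (in_event Y i (B i `&` total i)) * Pr (in_event Y j (B j `&` total j)))%E.
Proof.
move=> iS jS ij.
pose C k := if (k == i) || (k == j) then B k `&` total k else total k.
have -> : in_event Y i (B i) `&` in_event Y j (B j) `&` W =
    \bigcap_(k in [set` S]) in_event Y k (C k).
  apply/seteqP; split=> w.
    move=> [[Bi Bj] Ww] k kS; rewrite /C; have tk := Ww k kS.
    by case: ifP => // /orP[] /eqP ?; subst k; split.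
  move=> Cw; have tot k : k \in S -> in_event Y k (total k) w.
    by move=> kS; have := Cw k kS; rewrite /C; case: ifP => // _ [].
  split; last by move=> k kS; exact: tot.
  have := Cw i iS; have := Cw j jS; rewrite /C !eqxx orbT /=.
  by move=> [Bj _] [Bi _].
rewrite hindep; last by move=> k; rewrite inE.
rewrite (bigD1 i) //= (bigD1 j) /=; last by rewrite jS eq_sym.
rewrite big1 ?mule1 => [|k /andP[/andP[kS /negbTE ki] /negbTE kj]]; last first.
  by rewrite /C ki kj /= prob_total //; rewrite inE in kS.
by rewrite /C !eqxx orbT.
Qed.

Let prob_pt_total (k : 'I_m * counts) : (0 < n k.1)%N ->
  Pr (in_event Y k.1 ([set pt k.2] `&` total k.1)) = (pm k)%:E.
Proof.
move=> nk; have [tk|tk] := pselect (total k.1 (pt k.2)).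
  rewrite (_ : _ `&` _ = [set pt k.2]) ?hmult //.
  by apply/seteqP; split=> y /=; [case|move=> ->; split].
rewrite (_ : _ `&` _ = set0); last by apply/seteqP; split=> y //= [->].
by rewrite pm_eq0 // (_ : in_event _ _ _ = set0) ?measure0.
Qed.

(** Distinct settings are independent, and distinct count vectors at the same setting are disjoint
    events. *)
Let prob_EvI (k l : 'I_m * counts) : (0 < n k.1)%N -> (0 < n l.1)%N ->
  Pr (Ev k `&` Ev l) =
  (if k.1 == l.1 then (k.2 == l.2)%:R * pm k else pm k * pm l)%:E.
Proof.
move=> nk nl; have kS : k.1 \in S by rewrite inE.
have lS : l.1 \in S by rewrite inE.
rewrite /Ev setIACA setIid; case: ifPn => [/eqP kl1|kl]; last first.
  pose B i := if i == k.1 then [set pt k.2] else [set pt l.2].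
  have := prob_cap B kS lS kl.
  by rewrite /B eqxx eq_sym (negbTE kl) => ->; rewrite !prob_pt_total.
case: eqP => [kl2|kl2]; last first.
  rewrite mul0r (_ : _ `&` _ = set0) ?measure0 //.
  apply/seteqP; split=> w //= [[+ +] _]; rewrite /in_event -kl1 /= => -> kl.
  by apply: kl2; apply/ffunP => j; apply: val_inj; have := congr1 (fun f => f j) kl.
have -> : l = k by rewrite (surjective_pairing l) -kl1 -kl2 -surjective_pairing.
rewrite mul1r setIid -prob_pt_total //.
(* [prob_cap] needs two distinct settings; for k = l, W is absorbed likewise, with a single modified
   factor. *)
rewrite (_ : _ `&` _ =
    \bigcap_(i in [set` S]) in_event Y i
      (if i == k.1 then [set pt k.2] `&` total k.1 else total i)).
  rewrite hindep; last by move=> i; rewrite inE.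
  rewrite (bigD1 k.1) //= eqxx big1 ?mule1 // => i /andP[iS /negbTE ->].
  by rewrite prob_total //; rewrite inE in iS.
apply/seteqP; split=> w.
  move=> [kw Ww] i iS; case: eqP => [->|_]; last exact: Ww.
  by split=> //; exact: (Ww k.1).
move=> Cw; split.
  by have := Cw k.1 kS; rewrite eqxx => -[].
move=> i iS; have := Cw i iS; case: eqP => [->|_//].
by case.
Qed.

Let prob_Ev (k : 'I_m * counts) : (0 < n k.1)%N -> Pr (Ev k) = (pm k)%:E.
Proof.
by move=> nk; rewrite -[Ev k]setIid prob_EvI // !eqxx mul1r.
Qed.

Let score_coef (s : 'I_p) (i : 'I_m) (j : 'I_J) : R :=
  dcat_prob g h hc x theta (delta_mx s 0) i j / pi i j.

Let sc (s : 'I_p) (k : 'I_m * counts) : R :=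
  if (0 < n k.1)%N then \sum_j (pt k.2 j)%:R * score_coef s k.1 j else 0.

Let score_indic s : (fun w => score g h hc x n theta s (fun i j => Y i j w)) =
  (fun w => \sum_k sc s k * \1_(Ev k) w).
Proof.
(* Off W some observed setting has a wrong total and both sides are 0. On W, at each observed
   setting i, exactly one event [Ev (i, y)] occurs, the one with y = [obs w i]. *)
apply/funext => w; have [Ww|nWw] := pselect (W w); last first.
  rewrite big1 => [|k _]; last by rewrite indicE memNset ?mulr0 // => -[].
  have [i iS tw] : exists2 i, i \in S & ~ in_event Y i (total i) w.
    apply: contrapT => nex; apply: nWw => i iS; apply: contrapT => ntw.
    by apply: nex; exists i.
  have ni : (0 < n i)%N by rewrite inE in iS.
  have sw : (\sum_j (Y i j : T -> nat) w)%N != n i by apply/eqP => sw; apply: tw.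
  exact: score_eq0 ni sw.
rewrite scoreE //; last by move=> i ni; apply: (Ww i); rewrite /= inE.
rewrite -(pair_bigA _ (fun i y => sc s (i, y) * \1_(Ev (i, y)) w)) /=.
rewrite [LHS]big_mkcond; apply: eq_bigr => i _; case: ifPn => [ni|ni]; last first.
  by rewrite big1 // => y _; rewrite /sc /= (negbTE ni) mul0r.
have tw : in_event Y i (total i) w by apply: (Ww i); rewrite /= inE.
under [RHS]eq_bigr => y _.
  rewrite (_ : \1_(Ev (i, y)) w = (y == obs w i)%:R); last first.
    by rewrite -(indic_pt _ tw) /Ev indicI /= [X in _ * X]indicE mem_set // mulr1.
  over.
rewrite (bigD1 (obs w i)) //= [X in _ + X]big1 ?addr0 => [|y /negbTE ->];
  last by rewrite mulr0.
by rewrite eqxx mulr1 /sc /= ni (pt_obs tw).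
Qed.

(** The mean n_i pi_ij of a count cancels the division by pi_ij, which leaves n_i times the
    derivative of sum_j pi_ij = 1. *)
Let mean_sc s i : \sum_y sc s (i, y) * pm (i, y) = 0.
Proof.
rewrite /sc /=; case ni: (0 < n i)%N; last by rewrite big1 // => y _; rewrite mul0r.
under eq_bigr do rewrite big_distrl /=.
rewrite exchange_big /=.
have [pi_gt0 _ _] := cat_probP J_gt0 feas.
transitivity (\sum_j (n i)%:R * dcat_prob g h hc x theta (delta_mx s 0) i j).
  apply: eq_bigr => j _.
  under eq_bigr => y _ do rewrite mulrAC.
  rewrite -big_distrl /pm /pt /= (multinomial_mean (q := pi i)) ?ni ?n_le //.
  rewrite /score_coef -mulrA [X in _ * X]mulrC divfK //.
  by rewrite gt_eqF //; exact: pi_gt0.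
by rewrite -big_distrr /= dcat_prob_sum ?mulr0.
Qed.

Let mean_score s :
  expectation Pr (fun w => score g h hc x n theta s (fun i j => Y i j w)) = 0%:E.
Proof.
rewrite score_indic expectation_sum_indic //.
transitivity (\sum_k (sc s k * pm k)%:E)%E.
  apply: eq_bigr => k _; rewrite EFinM.
  have [nk|nk] := posnP (n k.1); last by rewrite prob_Ev.
  by rewrite /sc nk /= !mul0e.
rewrite sumEFin -(pair_bigA _ (fun i y => sc s (i, y) * pm (i, y))) /=.
by rewrite big1 // => i _; exact: mean_sc.
Qed.

Let fisherE s t : fisher g h hc x n Y theta s t =
  \sum_(k : 'I_m * counts) sc s k * sc t k * pm k.
Proof.
rewrite mxE (covariance_centered (mean_score s) (mean_score t)).
rewrite (expectation_mul_sum_indic Pr measurable_Ev (score_indic s) (score_indic t)).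
transitivity (fine (\sum_k (sc s k * sc t k * pm k)%:E)%E); last by rewrite sumEFin.
congr fine; apply: eq_bigr => k _.
(* [prob_EvI] covers observed settings only; at the others the coefficient [sc] is 0. *)
have [nk|nk] := posnP (n k.1).
  by rewrite /sc nk /= !mul0r big1 // => l _; rewrite mul0r mul0e.
transitivity (\sum_l ((sc s k * sc t l) *
   (if k.1 == l.1 then (k.2 == l.2)%:R * pm k else pm k * pm l))%:E)%E.
  apply: eq_bigr => l _; rewrite [RHS]EFinM.
  have [nl|nl] := posnP (n l.1); last by rewrite prob_EvI.
  have -> : sc t l = 0 by rewrite /sc nl.
  by rewrite mulr0 !mul0e.
rewrite sumEFin; congr EFin.
rewrite -(pair_bigA _ (fun i y => sc s k * sc t (i, y) *
  (if k.1 == i then (k.2 == y)%:R * pm k else pm k * pm (i, y)))) /=.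
(* For a setting other than [k.1] the probability factors, and the inner sum is the mean of a
   centered variable. *)
rewrite (bigD1 k.1) //= eqxx [X in _ + X]big1 ?addr0 => [|i /negbTE ik]; last first.
  under eq_bigr do rewrite eq_sym ik mulrACA.
  by rewrite -big_distrr /= mean_sc mulr0.
rewrite (bigD1 k.2) //= eqxx mul1r [X in _ + X]big1 ?addr0 => [|y /negbTE yk]; last first.
  by rewrite eq_sym yk mul0r mulr0.
by rewrite -surjective_pairing.
Qed.

Let sc_comb (v : 'cV[R]_p) (k : 'I_m * counts) : (0 < n k.1)%N ->
  \sum_s v s 0 * sc s k = \sum_j (pt k.2 j)%:R *
    ((\sum_s v s 0 * dcat_prob g h hc x theta (delta_mx s 0) k.1 j) / pi k.1 j).
Proof.
move=> nk; rewrite /sc nk; under eq_bigr do rewrite big_distrr /=.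
rewrite exchange_big; apply: eq_bigr => j _ /=.
rewrite big_distrl big_distrr; apply: eq_bigr => s _ /=.
by rewrite /score_coef mulrCA !mulrA.
Qed.

Let fisher_quad (v : 'cV[R]_p) :
  (v^T *m fisher g h hc x n Y theta *m v) 0 0 =
  \sum_k pm k * (\sum_s v s 0 * sc s k) ^+ 2.
Proof.
transitivity (\sum_t \sum_s \sum_k v s 0 * (sc s k * sc t k * pm k) * v t 0).
  rewrite mxE; apply: eq_bigr => t _; rewrite mxE big_distrl.
  by apply: eq_bigr => s _; rewrite mxE fisherE big_distrr big_distrl.
under eq_bigr do rewrite exchange_big.
rewrite exchange_big; apply: eq_bigr => k _ /=.
rewrite expr2 [X in _ * X]big_distrr /= big_distrr /=; apply: eq_bigr => t _.
rewrite big_distrl big_distrr /=; apply: eq_bigr => s _.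
by move: (sc s k) (sc t k) (pm k) (v s 0) (v t 0) => a b c e f; ring.
Qed.

Let pm_ge0 (k : 'I_m * counts) : 0 <= pm k.
Proof.
have [pi_gt0 _ _] := cat_probP J_gt0 feas.
rewrite /pm /multinomial_pmf; case: ifP => // _.
rewrite mulr_ge0 ?divr_ge0 // prodr_ge0 // => j _.
by rewrite exprn_ge0 // ltW //; exact: pi_gt0.
Qed.

Let pm_gt0 (k : 'I_m * counts) : total k.1 (pt k.2) -> 0 < pm k.
Proof.
have [pi_gt0 _ _] := cat_probP J_gt0 feas.
rewrite /total /pm /multinomial_pmf /= => ->; rewrite eqxx.
apply: mulr_gt0.
  by rewrite divr_gt0 ?ltr0n ?fact_gt0 ?prodn_gt0 // => j; exact: fact_gt0.
by apply: prodr_gt0 => j _; rewrite exprn_gt0 //; exact: pi_gt0.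
Qed.

(** By [fisher_quad] the form is a sum of squares with nonnegative weights, so it vanishes only if
    each weighted square does. *)
Lemma fisher_posdefP :
  posdefmx (fisher g h hc x n Y theta) <->
  forall v, (forall i j, (0 < n i)%N -> linpred h hc x v i j = 0) -> v = 0.
Proof.
have [pi_gt0 _ _] := cat_probP J_gt0 feas.
split=> [[_ pos] v lin0|ker0].
  apply/eqP; apply: contraT => /pos; rewrite fisher_quad big1 ?ltxx // => k _.
  have [nk|nk] := posnP (n k.1).
    by rewrite [X in X ^+ 2]big1 ?expr0n ?mulr0 // => s _; rewrite /sc nk mulr0.
  rewrite sc_comb // [X in X ^+ 2]big1 ?expr0n ?mulr0 // => j _.
  rewrite (dcat_prob_comb_eq0 v k.1 J_gt0 feas).2 ?mul0r ?mulr0 // => l.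
  exact: lin0.
split.
  apply/matrixP => s t; rewrite mxE !fisherE; apply: eq_bigr => k _.
  by move: (sc s k) (sc t k) => a b; rewrite (mulrC a).
move=> v v_neq0; rewrite fisher_quad.
have term_ge0 k : 0 <= pm k * (\sum_s v s 0 * sc s k) ^+ 2.
  by rewrite mulr_ge0 ?sqr_ge0.
rewrite lt_neqAle sumr_ge0 // andbT eq_sym; apply: contra v_neq0 => /eqP quad0.
apply/eqP; apply: ker0 => i j ni.
have [+ _] := dcat_prob_comb_eq0 v i J_gt0 feas; apply=> l {j}.
(* All [n i] observations in category l: this vector has positive probability, and its square
   isolates the l-th entry of the combined derivative, times the nonzero factor n_i / pi_il. *)
pose y : counts := [ffun j => if j == l then inord (n i) else ord0].
have yl : pt y l = n i by rewrite /pt ffunE eqxx inordK // ltnS n_le.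
have yE j : j != l -> pt y j = 0%N by move=> /negbTE jl; rewrite /pt ffunE jl.
have ty : total i (pt y).
  by rewrite /total /= (bigD1 l) //= yl big1 ?addn0 // => j; exact: yE.
have /eqP : pm (i, y) * (\sum_s v s 0 * sc s (i, y)) ^+ 2 = 0.
  by apply: (psumr_eq0P _ quad0) => // k _; exact: term_ge0.
rewrite mulf_eq0 gt_eqF ?pm_gt0 //= sqrf_eq0 sc_comb //=.
rewrite (bigD1 l) //= yl [X in _ + X]big1 ?addr0 => [|j /yE ->]; last by rewrite mul0r.
rewrite mulf_eq0 pnatr_eq0 (gtn_eqF ni) /= mulf_eq0 invr_eq0 => /orP[/eqP //|].
by rewrite gt_eqF //; exact: pi_gt0.
Qed.

End Sampling.

(** * The rank of the design matrix *)

Section DesignMatrix.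
Variables (R : realType) (d m J pc : nat) (p_ : 'I_J.-1 -> nat).
Local Notation p := ((\sum_(j < J.-1) p_ j) + pc)%N.
Variables (h : forall j : 'I_J.-1, 'cV[R]_d -> 'cV[R]_(p_ j)).
Variables (hc : 'cV[R]_d -> 'cV[R]_pc) (x : 'I_m -> 'cV[R]_d).

(** In the upper part only the diagonal block of the column survives and gives the beta term; the
    repeated bottom block gives the zeta term. *)
Lemma mul_designH (v : 'cV[R]_p) (c : 'I_(\sum_(j < J.-1) m)) :
  (v^T *m designH h hc x) 0 c =
  linpred h hc x v (tagnat.sig2 c) (tagnat.sig1 c).
Proof.
rewrite /designH -{1}[v]vsubmxK tr_col_mx mul_row_col.
rewrite -{1}[usubmx v]submxcolK tr_mxcol mul_mxrow_mxblock mul_mxrow.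
rewrite /linpred [LHS]mxE [RHS]mxE; congr (_ + _).
  rewrite [LHS]mxE summxE; transitivity
      (((beta v (tagnat.sig1 c))^T *m blockH h x (tagnat.sig1 c)) 0 (tagnat.sig2 c)).
    apply: etrans; first apply: (@big_only1 _ _ _ _ (tagnat.sig1 c)) => // j jc _.
      by rewrite (negbTE jc) mulmx0 mxE.
    by rewrite eqxx.
  by rewrite [LHS]mxE [RHS]mxE; apply: eq_bigr => s _; rewrite !mxE mulrC.
rewrite [LHS]mxE [LHS]mxE [RHS]mxE.
by apply: eq_bigr => s _; rewrite /zeta !mxE mulrC.
Qed.

(** An arbitrary selection f of columns covers both the reduced matrix, with f enumerating the kept
    columns, and the full one, with f the identity. *)
Lemma row_free_colsub_designH (q : nat) (f : 'I_q -> 'I_(\sum_(j < J.-1) m)) :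
  row_free (colsub f (designH h hc x)) <->
  forall v, (forall c, linpred h hc x v (tagnat.sig2 (f c)) (tagnat.sig1 (f c)) = 0) ->
    v = 0.
Proof.
have mulE v c : (v^T *m colsub f (designH h hc x)) 0 c =
    linpred h hc x v (tagnat.sig2 (f c)) (tagnat.sig1 (f c)).
  by rewrite -mul_designH !mxE; apply: eq_bigr => s _; rewrite !mxE.
split=> [free v lin0|ker0].
  apply: trmx_inj; apply: (row_free_inj free); rewrite trmx0 mul0mx.
  by apply/rowP => c; rewrite mulE lin0 mxE.
apply: inj_row_free => u uH0; apply: trmx_inj; rewrite trmx0; apply: ker0 => c.
by rewrite -mulE trmxK uH0 mxE.
Qed.

Lemma row_free_designHstarP (n : 'I_m -> nat) :
  row_free (designHstar h hc x n) <->
  forall v, (forall i j, (0 < n i)%N -> linpred h hc x v i j = 0) -> v = 0.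
Proof.
rewrite row_free_colsub_designH; split=> ker0 v lin0; apply: ker0.
  by move=> c; apply: lin0; have := enum_valP c; rewrite inE.
move=> i j ni; pose c := @tagnat.Rank _ (fun=> m) j i.
have c1 : tagnat.sig1 c = j by rewrite /c tagnat.Rank1K.
have c2 : tagnat.sig2 c = i :> 'I_m by apply: val_inj; rewrite /c tagnat.Rank2K.
have ck : c \in kept_cols J n by rewrite inE c2.
by have := lin0 (enum_rank_in ck c); rewrite enum_rankK_in // c1 c2.
Qed.

Lemma row_free_designHP :
  row_free (designH h hc x) <->
  forall v, (forall i j, linpred h hc x v i j = 0) -> v = 0.
Proof.
have -> : designH h hc x = colsub id (designH h hc x).
  by apply/matrixP => i j; rewrite !mxE.
rewrite row_free_colsub_designH; split=> ker0 v lin0; apply: ker0.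
  by move=> c; exact: lin0.
move=> i j; pose c := @tagnat.Rank _ (fun=> m) j i.
have c1 : tagnat.sig1 c = j by rewrite /c tagnat.Rank1K.
have c2 : tagnat.sig2 c = i :> 'I_m by apply: val_inj; rewrite /c tagnat.Rank2K.
by have := lin0 c; rewrite c1 c2.
Qed.

End DesignMatrix.

Theorem theorem3p2 (R : realType) (g : logit_type) (d m J pc : nat)
    (p_ : 'I_J.-1 -> nat)
    (hd : (1 <= d)%N) (hm : (2 <= m)%N) (hJ : (2 <= J)%N)
    (h : forall j : 'I_J.-1, 'cV[R]_d -> 'cV[R]_(p_ j))
    (hc : 'cV[R]_d -> 'cV[R]_pc)
    (x : 'I_m -> 'cV[R]_d) (hx : injective x)
    (n : 'I_m -> nat) (hn : (0 < \sum_(i < m) n i)%N)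
    (theta : 'cV[R]_((\sum_(j < J.-1) p_ j) + pc))
    (htheta : feasible g h hc x theta)
    (disp : measure_display) (T : measurableType disp)
    (Pr : probability T R) (Y : 'I_m -> 'I_J -> {RV Pr >-> nat})
    (hmult : multinomial_counts g h hc x n Y theta)
    (hindep : independent_counts n Y) :
  (posdefmx (fisher g h hc x n Y theta) <->
     row_free (designHstar h hc x n)) /\
  ((forall i, (0 < n i)%N) ->
     (posdefmx (fisher g h hc x n Y theta) <-> row_free (designH h hc x))).
Proof.
have J_gt0 : (0 < J)%N by exact: ltnW.
(* Positive definiteness and row freeness are compared through the same condition on the linear
   predictors of v. *)
have posP := fisher_posdefP J_gt0 htheta hmult hindep.
split=> [|n_gt0]; first by rewrite posP row_free_designHstarP.
rewrite posP row_free_designHP; split=> ker0 v lin0; apply: ker0 => //.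
by move=> i j; exact: lin0.
Qed.
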